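(* Let $G$ be a finite abelian group. Then $G$ is a DDP group if and only if $G$ has exactly one element of order 2.
   Context: A finite group $G$ of order $n$ is a DDP group if there is a permutation $g_0,\ldots,g_{n-1}$ of the elements of $G$ (each element listed exactly once) such that $g_0=1_G$ and $g_i^{-1}g_{i+1}\neq g_j^{-1}g_{j+1}$ for all $0\le i<j<n-1$.
   Formalization: The group G is additionally assumed to be nontrivial: the trivial group is a DDP group vacuously but has no element of order 2, so the statement fails for it. *)

(* Defs.v *)
From mathcomp Require Import all_boot all_fingroup.

Set Implicit Arguments.
Unset Strict Implicit.
Unset Printing Implicit Defensive.

Local Open Scope group_scope.

(* The listing g_0, ..., g_{n-1} is the sequence s; [uniq s] and [s =i G] force
   [size s = #|G|], so every index below is in range and the default value of
   [nth] is never reached.  The bound j < n - 1 reads [j.+1 < #|G|].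
   For #|G| = 1 the conditions are vacuous, so the trivial group is DDP. *)
Definition DDP (gT : finGroupType) (G : {group gT}) : Prop :=
  exists s : seq gT,
    [/\ uniq s,
        s =i G,
        nth 1 s 0 = 1 &
        forall i j : nat, i < j -> j.+1 < #|G| ->
          (nth 1 s i)^-1 * nth 1 s i.+1 <> (nth 1 s j)^-1 * nth 1 s j.+1].

(* Main.v *)
Require Import Defs.
From mathcomp Require Import all_boot all_fingroup.
From mathcomp Require Import all_algebra all_solvable zify.

(* Necessity: the n - 1 quotients are pairwise distinct and nontrivial, hence
   are all the nontrivial elements, and their product telescopes to
   g_(n-1) <> 1.  So the product S of all the elements of G is nontrivial;
   S = S^-1, and pairing x with x^-1 and then x with x z shows that S is 1 or z
   for every involution z, whence S is the only involution.

   Sufficiency: the Sylow 2-subgroup <a> is cyclic, and G = <a> x B with |B|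
   odd.  There is an enumeration h of B indexed by integers mod |B| such that
   h i * h j = 1 when i + j + 1 = 0 mod |B| and such that i |-> h i * h (i + 1)
   is injective.  With U j = h j * a ^ j, the zigzag
   (U 0)^-1, (U 0) a, (U 1)^-1, (U 1) a, ... is, up to translation, the desired
   listing.  The enumeration h comes from a chain of subgroups of prime index
   from B down to 1: if h is such an enumeration of representatives of B / C and
   c generates C modulo D, with |C : D| = p and |B : C| = m, then
   h (r + m q) * c ^ (q - (p - 1) / 2) is one for B / D. *)

Set Implicit Arguments.
Unset Strict Implicit.
Unset Printing Implicit Defensive.

Import GRing.Theory FiniteModule.

(** * Sum of all elements of a finite abelian group *)

Lemma big_pairing (V : nmodType) (I : finType) (P : pred I) (f : I -> I)
    (F : I -> V) :
  involutive f -> (forall i, P (f i) = P i) -> (forall i, P i -> f i != i) ->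
  (\sum_(i | P i) F i =
   \sum_(i | P i && (enum_rank i < enum_rank (f i))%N) (F i + F (f i)))%R.
Proof.
move=> fK Pf f_fix; rewrite big_split /=.
(* Each orbit of [f] is represented by its member of smaller [enum_rank]; the other members are
   reindexed through [f]. *)
rewrite (bigID (fun i => enum_rank i < enum_rank (f i))%N) /=.
congr (_ + _)%R; rewrite (reindex_inj (inv_inj fK)) /=.
apply: eq_bigl => i; rewrite Pf fK; case Pi: (P i) => //=.
rewrite -leqNgt leq_eqVlt; case: eqP => // /ord_inj/enum_rank_inj e.
by case/eqP: (f_fix i Pi).
Qed.

Lemma sum_all_double (V : finZmodType) :
  ((\sum_(x : V) x) *+ 2 = 0)%R.
Proof. by rewrite mulr2n {2}(reindex_inj oppr_inj) sumrN subrr. Qed.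

(** Elements with [x *+ 2 != 0] cancel against their opposites. The others pair as [x], [x + z],
    each pair adding up to [z]; the total is thus a multiple of [z]. *)
Lemma sum_all_involution (V : finZmodType) (z : V) :
    (z != 0)%R -> (z *+ 2 = 0)%R -> (\sum_(x : V) x != 0)%R ->
  (\sum_(x : V) x = z)%R.
Proof.
move=> z0 z2; rewrite (bigID (fun x : V => x *+ 2 == 0)%R) /=.
rewrite [X in (_ + X)%R](@big_pairing _ _ _ -%R%R) /=; first last.
- by move=> x; apply: contraNneq => e; rewrite mulr2n -{1}e addNr.
- by move=> x; rewrite mulNrn oppr_eq0.
- exact: opprK.
rewrite [X in (_ + X)%R]big1 => [|x _]; last by rewrite subrr.
rewrite addr0 (@big_pairing _ _ _ (fun x => x + z)%R) /=; first last.
- by move=> x _; rewrite -subr_eq0 addrC addKr.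
- by move=> x; rewrite mulrnDl z2 addr0.
- by move=> x; rewrite -addrA -mulr2n z2 addr0.
rewrite (eq_bigr (fun=> z)) => [|x /andP[/eqP x2 _]]; last first.
  by rewrite addrA -mulr2n x2 add0r.
(* Only the parity of the number of pairs matters, since [z *+ 2 = 0]; an even number would make the
   sum zero. *)
rewrite sumr_const -[#|_|]odd_double_half -muln2 mulnC mulrnDr mulrnA z2 mul0rn addr0.
by case: odd; rewrite ?eqxx.
Qed.

(** * Necessity *)

Lemma DDP_sum_neq0 (gT : finGroupType) (G : {group gT}) (abG : abelian G) :
  1 < #|G| -> DDP G -> (\sum_(x : fmod_of abG) x != 0)%R.
Proof.
move=> G1 [s [us sG s0 ds]].
have szs: size s = #|G| by rewrite -(card_uniqP us); apply: eq_card.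
have Gs i : i < #|G| -> nth 1%g s i \in G.
  by move=> ltiG; rewrite -sG mem_nth ?szs.
pose f i := fmod abG (nth 1%g s i).
pose t := [seq (f i.+1 - f i)%R | i <- iota 0 #|G|.-1].
have t_s i : i.+1 < #|G| ->
    (f i.+1 - f i)%R = fmod abG ((nth 1 s i)^-1 * nth 1 s i.+1)%g.
  by move=> lti; rewrite fmodM ?groupV ?Gs ?fmodV ?(addrC (fmod _ _)) // ltnW.
have inj_t i j : i < j -> j.+1 < #|G| -> (f i.+1 - f i <> f j.+1 - f j)%R.
  move=> ij ltj; have lti: i.+1 < #|G| by apply: leq_ltn_trans ltj; apply: ltnW.
  rewrite !t_s // => /(congr1 val).
  by rewrite !fmodK ?groupM ?groupV ?Gs ?(ltnW lti) ?(ltnW ltj) //; apply: ds.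
have ut: uniq t.
  rewrite map_inj_in_uniq ?iota_uniq // => i j; rewrite !mem_iota /= => lti ltj e.
  have [ij|ji|//] := ltngtP i j; [case: (inj_t i j ij) | case: (inj_t j i ji)];
  by rewrite // -ltn_predRL.
have t0: (0 \notin t)%R.
  apply/mapP => -[i]; rewrite mem_iota /= add0n ltn_predRL => lti /esym/eqP.
  rewrite subr_eq0 => /eqP/(congr1 val); rewrite !fmodK ?Gs ?(ltnW lti) // => /eqP.
  by rewrite nth_uniq ?szs ?(ltnW lti) // (gtn_eqF (ltnSn i)).
have cardV: #|{: fmod_of abG}| = #|G|.
  rewrite -cardsT -(card_injm (injm_fmod abG) (subxx _)).
  by apply: eq_card => u; rewrite inE -(fmvalK u) mem_morphim ?fmodP.
(* [0 :: t] has as many distinct entries as the group has elements, so the sum over the group is the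
   sum of [t], which telescopes. *)
have tV: perm_eq (0%R :: t) (index_enum (fmod_of abG)).
  apply: uniq_perm; rewrite ?index_enum_uniq /= ?t0 //.
  have ut0 : uniq (0%R :: t) by rewrite /= t0.
  move=> x; rewrite mem_index_enum.
  have/subset_cardP/(_ (subset_predT _)) -> // : #|0%R :: t| = #|{: fmod_of abG}|.
  by rewrite (card_uniqP ut0) /= size_map size_iota cardV prednK // ltnW.
rewrite -(perm_big _ tV) big_cons /= add0r big_map /=.
rewrite -{1}[#|G|.-1]subn0 -/(index_iota 0 _) telescope_sumr //.
have n0 := ltnW G1; have lastG : #|G|.-1 < #|G| by rewrite prednK.
rewrite /f s0 fmod1 subr0; apply/eqP => /(congr1 val).
rewrite fmodK ?Gs // => e; have := nth_uniq (1%g : gT) (i := #|G|.-1) (j := 0).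
by move/(_ s); rewrite s0 szs e eqxx => /(_ lastG n0 us) /esym/eqP; lia.
Qed.

(** The sum of all elements is itself the involution: it is nonzero, and zero when doubled. *)
Lemma DDP_unique_involution (gT : finGroupType) (G : {group gT}) (abG : abelian G) :
  1 < #|G| -> DDP G -> exists! x : gT, x \in G /\ #[x]%g = 2.
Proof.
move=> G1 /(DDP_sum_neq0 abG G1) S0.
exists (val (\sum_(x : fmod_of abG) x)%R); split.
  split; first exact: fmodP.
  by apply: nt_prime_order => //; rewrite -fmvalZ sum_all_double.
move=> z [Gz oz]; rewrite (@sum_all_involution _ (fmod abG z)) ?fmodK //.
  rewrite -(fmod1 abG) (inj_in_eq (injmP (injm_fmod abG))) //.
  by rewrite -order_eq1 oz.
by rewrite -fmodX // -oz expg_order fmod1.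
Qed.

(** * Balanced enumerations of abelian groups of odd order *)

Local Open Scope group_scope.

(** Representatives of [B / C], indexed by integers modulo [#|B : C|] through a periodic function on
    [nat]. The relation [h i * h j = 1] holds in [B] itself; the injectivity clauses are modulo
    [C]. *)
Definition balanced_mod {gT : finGroupType} (B C : {group gT}) (h : nat -> gT) :=
  [/\ forall i, h i \in B,
      forall i j, i = j %[mod #|B : C|] -> h i = h j,
      forall i j, #|B : C| %| (i + j).+1 -> h i * h j = 1,
      forall i j, coset C (h i) = coset C (h j) -> i = j %[mod #|B : C|] &
      forall i j, coset C (h i * h i.+1) = coset C (h j * h j.+1) ->
        i = j %[mod #|B : C|]].

Lemma eqn_mod_mul m p i j :
  0 < m ->
  i = j %[mod m * p] <-> i = j %[mod m] /\ i %/ m = j %/ m %[mod p].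
Proof.
move=> m0; split=> [e|[e1 e2]].
  split; first by have := congr1 (modn^~ m) e; rewrite !modn_dvdm ?dvdn_mulr.
  by rewrite !modn_divl (mulnC p) e.
rewrite (divn_eq (i %% _) m) (divn_eq (j %% _) m).
rewrite (mulnC m) -!modn_divl e2.
by rewrite !modn_dvdm ?dvdn_mull // e1.
Qed.

(** The remainders add up to at most [2d - 2] and to -1 modulo [d], hence to [d - 1]. *)
Lemma dvdn_succ_add d i j : 0 < d -> d %| (i + j).+1 ->
  i %% d + j %% d = d.-1 /\ ((i + j).+1 %/ d)%N = (i %/ d + j %/ d).+1.
Proof.
move=> d0 /dvdnP[k e].
have li := ltn_pmod i d0; have lj := ltn_pmod j d0.
have ei := divn_eq i d; have ej := divn_eq j d.
have e2 : ((i %/ d + j %/ d) * d + (i %% d + j %% d).+1 = k * d)%N.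
  by rewrite -e; lia.
have ek : k = (i %/ d + j %/ d).+1 by nia.
by rewrite e mulnK //; split=> //; nia.
Qed.

Lemma coprime_modM2l_inj p k i j :
  coprime p k -> k * i = k * j %[mod p] -> i = j %[mod p].
Proof.
move=> co; wlog le : i j / j <= i => [W|/eqP].
  by case/orP: (leq_total j i) => le e; [|symmetry]; apply: W.
rewrite eqn_mod_dvd ?leq_mul2l ?le ?orbT // -mulnBr Gauss_dvdr //.
by rewrite -eqn_mod_dvd // => /eqP.
Qed.

Lemma abelian_coset_subset (gT : finGroupType) (B C D : {group gT}) x y :
    abelian B -> D \subset C -> C \subset B -> x \in B -> y \in B ->
  coset D x = coset D y -> coset C x = coset C y.
Proof.
move=> abB sDC sCB Bx By.
have N (H : {group gT}) u : H \subset B -> u \in B -> u \in 'N(H).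
  by move=> sHB Bu; apply: (subsetP (sub_abelian_norm abB sHB)).
have sDB := subset_trans sDC sCB.
move=> /(rcoset_kercosetP (N _ _ sDB Bx) (N _ _ sDB By)).
rewrite mem_rcoset => Dxy; apply/(rcoset_kercosetP (N _ _ sCB Bx) (N _ _ sCB By)).
by rewrite mem_rcoset (subsetP sDC).
Qed.

(** Modulo [C] the new enumeration is the old one, which recovers [i] modulo [m]; the power of [c]
    then recovers [q i]. For products of neighbours the exponent is, up to a constant, [2 q] plus a
    carry, and 2 is invertible modulo the odd [p]. *)
Lemma balanced_mod_refine (gT : finGroupType) (B C D : {group gT}) h :
    abelian B -> odd #|B| -> C \subset B -> D \subset C -> prime #|C : D| ->
  balanced_mod B C h -> exists h', balanced_mod B D h'.
Proof.
move=> abB oddB sCB sDC pr_p [Bh per_h sym_h inj_h inj2_h].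
have sDB := subset_trans sDC sCB.
have nDB : B \subset 'N(D) := sub_abelian_norm abB sDB.
have N u : u \in B -> u \in 'N(D) by apply: subsetP.
have eM : #|B : D| = (#|B : C| * #|C : D|)%N by rewrite Lagrange_index.
have := dvdn_odd (dvdn_indexg B D) oddB; rewrite eM oddM.
set m := #|B : C| in per_h sym_h inj_h inj2_h eM *.
set p := #|C : D| in pr_p eM *.
move=> /andP[odd_m odd_p].
have m0 : 0 < m by apply: indexg_gt0.
have p0 : 0 < p by apply: indexg_gt0.
have [c Cc ocp] : exists2 c, c \in C & #[coset D c] = p.
  have nDC := subset_trans sCB nDB.
  have opC : #|C / D| = p by rewrite card_quotient.
  have /cyclicP[x ex] : cyclic (C / D) by rewrite prime_cyclic ?opC.
  have /morphimP[c Nc Cc ec] : x \in C / D by rewrite ex cycle_id.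
  by exists c => //; rewrite orderE -opC ex ec.
have Bc : c \in B by apply: subsetP sCB c Cc.
have comm x y : x \in B -> y \in B -> commute x y by move=> ? ?; apply: (centsP abB).
(* As [p] is odd, [r] is [(p - 1) / 2]; subtracting it makes the exponents at [q] and [p - 1 - q]
   opposite. *)
pose r := p./2.
pose q i := (i %/ m) %% p.
pose h' i := h i * (c ^+ q i * (c ^+ r)^-1).
have Bh' i : h' i \in B by rewrite !groupM ?groupV ?groupX.
have h'C i : coset C (h' i) = coset C (h i).
  have NC := subsetP (sub_abelian_norm abB sCB).
  apply/(rcoset_kercosetP (NC _ (Bh' i)) (NC _ (Bh i))).
  by rewrite mem_rcoset /h' (comm (h i)) ?mulgK ?groupM ?groupV ?groupX.
have h2 i : h' i * h' i.+1 =
    (h i * h i.+1) * (c ^+ (q i + q i.+1) * ((c ^+ r)^-1 ^+ 2)).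
  rewrite /h' expgD expg2.
  set u := c ^+ q i; set v := c ^+ q i.+1; set w := _^-1.
  have [Bu Bv Bw] : [/\ u \in B, v \in B & w \in B] by rewrite ?groupV !groupX.
  rewrite -!mulgA; congr (_ * _).
  rewrite [RHS]mulgA -[h i.+1 * u](comm _ _ Bu (Bh _)) -!mulgA; congr (_ * _).
  rewrite mulgA [w * _](comm _ _ Bw (Bh _)) -!mulgA; congr (_ * _).
  by rewrite mulgA [w * v](comm _ _ Bw Bv) -mulgA.
have cosetX n n' : coset D (c ^+ n) = coset D (c ^+ n') -> n = n' %[mod p].
  by rewrite !morphX ?N // => /eqP; rewrite eq_expg_mod_order ocp => /eqP.
have canL u x y : u \in B -> x \in B -> y \in B ->
    coset D (u * x) = coset D (u * y) -> coset D x = coset D y.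
  by move=> Bu Bx By; rewrite !morphM ?N // => /mulgI.
have canR u x y : u \in B -> x \in B -> y \in B ->
    coset D (x * u) = coset D (y * u) -> coset D x = coset D y.
  by move=> Bu Bx By; rewrite !morphM ?N // => /mulIg.
have Bc1 n : c ^+ n \in B by rewrite groupX.
have inj_m i j : coset D (h' i) = coset D (h' j) -> i = j %[mod m].
  by move=> e; apply: inj_h; rewrite -2!h'C; apply: (abelian_coset_subset abB sDC sCB) e.
exists h'; split=> //; rewrite eM.
- move=> i j /(eqn_mod_mul _ _ _ m0)[em ep].
  by rewrite /h' (per_h i j em) /q ep.
(* Used for [m] and then for [p], [dvdn_succ_add] gives [q i + q j = p - 1 = 2 r], so the powers of
   [c] cancel exactly. *)
- move=> i j dvd; have dm := dvdn_trans (dvdn_mulr p (dvdnn m)) dvd.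
  have [_ eq] := dvdn_succ_add m0 dm.
  have dp : p %| (i %/ m + j %/ m).+1.
    by rewrite -eq dvdn_divRL // mulnC.
  have [eqr _] := dvdn_succ_add p0 dp.
  rewrite /h'; set u := _ * _^-1; set v := _ * _^-1.
  have [Bu Bv] : u \in B /\ v \in B by rewrite !groupM ?groupV ?groupX.
  rewrite mulgA -(mulgA (h i)) (comm _ _ Bu (Bh j)) (mulgA (h i)) sym_h // mul1g.
  rewrite /u /v -!expVgn -/(q i) -/(q j).
  rewrite mulgA -(mulgA (c ^+ q i)) (comm (c^-1 ^+ r)) ?groupX ?groupV //.
  rewrite mulgA -expgD -mulgA -expgD -/(q i) addnn /q eqr /r.
  by rewrite odd_halfK // expVgn mulgV.
- move=> i j e; apply/(eqn_mod_mul _ _ _ m0); have em := inj_m i j e.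
  split=> //; move: e; rewrite /h' (per_h i j em).
  move/canL; rewrite !groupM ?groupV ?Bh // => /(_ isT isT isT) /canR.
  rewrite groupV !Bc1 => /(_ isT isT isT) /cosetX.
  by rewrite !modn_mod.
move=> i j e; apply/(eqn_mod_mul _ _ _ m0).
have em : i = j %[mod m].
  have NC := subsetP (sub_abelian_norm abB sCB).
  have h2C k : coset C (h' k * h' k.+1) = coset C (h k * h k.+1).
    by rewrite (morphM _ (NC _ (Bh' _)) (NC _ (Bh' _))) /= !h'C morphM ?NC.
  apply: inj2_h; rewrite -!h2C.
  by apply: (abelian_coset_subset abB sDC sCB) e => //; apply: groupM (Bh' _) (Bh' _).
have eS : i.+1 = j.+1 %[mod m].
  by apply/eqP; rewrite -(addn1 i) -(addn1 j) eqn_modDr em.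
split=> //; move: e; rewrite !h2 (per_h i j em) (per_h _ _ eS).
move/canL; rewrite !groupM ?groupX ?groupV ?groupX ?Bh // => /(_ isT isT isT) /canR.
rewrite groupX ?groupV // !Bc1 => /(_ isT isT isT) /cosetX.
(* [divnS] exposes the carry [b] from [i] to [i.+1]; by [eS] it is the same for [j] and drops
   out. *)
rewrite /q !modnDm !divnS // /dvdn eS.
set b := (_ == _ :> nat) => /eqP.
rewrite ![(b + _)%N]addnC !addnA !eqn_modDr !addnn -!muln2 !(mulnC _ 2).
have co : coprime p 2 by rewrite coprime_sym prime_coprime // dvdn2 odd_p.
by move/eqP/(coprime_modM2l_inj co).
Qed.

(** For a maximal normal subgroup [D] of [C], the quotient [C / D] is simple and solvable, hence of
    prime order, so refinement continues down to the trivial subgroup. *)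
Lemma balanced_mod1 (gT : finGroupType) (B C : {group gT}) h :
    abelian B -> odd #|B| -> C \subset B -> balanced_mod B C h ->
  exists h', balanced_mod B 1 h'.
Proof.
move=> abB oddB; elim/ltn_ind: {C}#|C| {-2}C (leqnn #|C|) h => n IHn C leCn h sCB hC.
have [C1|ntC] := eqVneq (C : {set gT}) 1.
  by exists h; have -> : 1%G = C by apply/val_inj.
have [D maxD] := ex_maxnormal_ntrivg ntC.
have nsDC := maxnormal_normal maxD; have sDC := normal_sub nsDC.
have ltDC := proper_card (maxnormal_proper maxD).
have pr : prime #|C : D|.
  rewrite -card_quotient ?normal_norm //; apply: simple_sol_prime.
    by rewrite quotient_sol ?abelian_sol ?(abelianS sCB).
  by rewrite quotient_simple.
have [h' hD] := balanced_mod_refine abB oddB sCB sDC pr hC.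
by apply: (IHn #|D| _ D _ h') => //; [apply: leq_trans leCn | apply: subset_trans sCB].
Qed.

Lemma odd_abelian_balanced (gT : finGroupType) (B : {group gT}) :
  abelian B -> odd #|B| ->
  exists h : nat -> gT,
  [/\ forall i, h i \in B,
      forall i j, i = j %[mod #|B|] -> h i = h j,
      forall i j, #|B| %| (i + j).+1 -> h i * h j = 1,
      forall i j, h i = h j -> i = j %[mod #|B|] &
      forall i j, h i * h i.+1 = h j * h j.+1 -> i = j %[mod #|B|]].
Proof.
move=> abB oddB.
(* The descent starts at [C = B], where the index is 1 and the constant 1 is balanced. *)
have [|h [Bh per sym inj inj2]] := @balanced_mod1 _ B B (fun=> 1) abB oddB (subxx _).
  by split=> *; rewrite ?group1 ?mulg1 ?indexgg ?modn1.
move: per sym inj inj2; rewrite indexg1 => per sym inj inj2.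
by exists h; split=> // i j e; [apply: inj | apply: inj2]; rewrite e.
Qed.

(** * The zigzag listing *)

Lemma zigzag_DDP (gT : finGroupType) (G B : {group gT}) (a : gT) :
    abelian G -> <[a]> \x B = G -> ~~ odd #[a] -> odd #|B| ->
    coprime #[a] #|B| -> DDP G.
Proof.
move=> abG dG even_a odd_B co.
have [_ eG _ tiAB] := dprodP dG.
have cardG : (#[a] * #|B|)%N = #|G| := dprod_card dG.
have Ga : a \in G by rewrite -eG (subsetP (mulG_subl _ _)) ?cycle_id.
have sBG : B \subset G by rewrite -eG mulG_subr.
have Bcom x y : x \in B -> y \in G -> commute x y.
  by move=> Bx Gy; apply: (centsP abG) => //; apply: (subsetP sBG).
have [h [Bh per sym inj inj2]] := odd_abelian_balanced (abelianS sBG abG) odd_B.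
have PM x y m n : x \in B -> y \in B ->
    (x * a ^+ m) * (y * a ^+ n) = (x * y) * a ^+ (m + n).
  move=> Bx By; rewrite -mulgA (mulgA _ y) -(Bcom y (a ^+ m)) ?groupX // -!mulgA.
  by rewrite expgD.
have Pinj x y m n : x \in B -> y \in B -> x * a ^+ m = y * a ^+ n ->
    x = y /\ m = n %[mod #[a]].
  move=> Bx By e.
  have e1 : y^-1 * x = a ^+ n * (a ^+ m)^-1.
    by apply: (mulgI y); rewrite mulKVg mulgA -e mulgK.
  have : y^-1 * x \in <[a]> :&: B.
    by rewrite inE {1}e1 !groupM ?groupV ?mem_cycle.
  rewrite tiAB => /set1gP e2; split; first by apply: (mulgI y^-1); rewrite e2 mulVg.
  apply/eqP; rewrite -eq_expg_mod_order eq_sym eq_mulgV1.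
  by rewrite -e1 e2.
pose U j := h j * a ^+ j.
pose f k := if odd k then U k./2 * a else (U k./2)^-1.
have GU j : U j \in G by rewrite groupM ?groupX // (subsetP sBG).
have Gf k : f k \in G by rewrite /f; case: odd; rewrite ?groupV // groupM.
have Ua j : U j * a = h j * a ^+ j.+1 by rewrite /U -mulgA -expgSr.
have a0 : 0 < #[a] := order_gt0 a.
have B0 : 0 < #|B| := cardG_gt0 B.
have a2 : #[a] = (2 * #[a]./2)%N by rewrite mul2n even_halfK.
have n2 : #|G| = (2 * (#[a]./2 * #|B|))%N by rewrite mulnA -a2.
have U_inj i j : i < #|G| -> j < #|G| -> U i = U j -> i = j.
  move=> li lj /Pinj [] // /inj /eqP e1 /eqP e2; apply/eqP.
  by rewrite -(modn_small li) -(modn_small lj) -cardG chinese_remainder ?e1 ?e2.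
(* Equality would force [h i * h j = 1] and [#[a]] to divide [i + j + 1]. The former makes [#|B|]
   divide it too, so [#|G|] would divide a smaller positive number. *)
have U_anti i j : (i + j).+1 < #|G| -> (U i)^-1 <> U j * a.
  move=> lt e; have : U i * (U j * a) = 1 * a ^+ 0 by rewrite -e mulgV mulg1.
  rewrite Ua PM // => /Pinj [] //; first by rewrite groupM.
  move=> eh; rewrite addnS mod0n => /eqP da.
  (* A natural number congruent to [-i - 1] modulo [#|B|], so that [h i'] inverts [h i]. *)
  pose i' := (i.+1 * #|B| - i.+1)%N.
  have ei : (i + i').+1 = (i.+1 * #|B|)%N by rewrite /i'; nia.
  have ej : h i' = h j.
    by apply: (mulgI (h i)); rewrite eh sym // ei dvdn_mull.
  have dB : #|B| %| (i + j).+1.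
    rewrite /dvdn -addSn -modnDmr -(inj _ _ ej) modnDmr addSn ei.
    by rewrite modnMl.
  have : #|G| %| (i + j).+1 by rewrite -cardG Gauss_dvd // dB andbT.
  by move/(dvdn_leq (ltn0Sn _)); rewrite leqNgt lt.
have f_inj i j : i < #|G| -> j < #|G| -> f i = f j -> i = j.
  move=> li lj; have := odd_double_half i; have := odd_double_half j.
  rewrite /f -!muln2; case: (odd i); case: (odd j) => ei ej; last 1 first.
  - by move/invg_inj/U_inj; lia.
  - by move/mulIg/U_inj; lia.
  - by move/esym/U_anti; lia.
  - by move/U_anti; lia.
(* Doubling loses a factor 2 of [#[a]], so the residues fix an index only modulo [#|G| / 2], which
   is the range of [j] in the zigzag. *)
have half_inj i j : i < #[a]./2 * #|B| -> j < #[a]./2 * #|B| ->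
    i = j %[mod #|B|] -> i.*2 = j.*2 %[mod #[a]] -> i = j.
  move=> li lj e1 e2; apply/eqP; rewrite -(modn_small li) -(modn_small lj).
  have co2 : coprime #[a]./2 #|B|.
    by apply: coprime_dvdl co; rewrite {2}a2 dvdn_mull.
  rewrite chinese_remainder // e1 eqxx andbT -(@eqn_pmul2l 2) // !muln_modr.
  by rewrite -a2 !mul2n e2.
have quo_even j : (f j.*2)^-1 * f j.*2.+1 = h j ^+ 2 * a ^+ j.*2.+1.
  by rewrite /f /= odd_double /= doubleK uphalf_double invgK Ua PM // addnS addnn.
have quo_odd j : (f j.*2.+1)^-1 * f j.*2.+2 = (h j * h j.+1 * a ^+ j.+1.*2)^-1.
  rewrite /f /= odd_double /= doubleK uphalf_double -invMg Ua PM //.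
  by rewrite (centsP (abelianS sBG abG) _ (Bh _)) // addnn.
have sq_inj x y : x \in B -> y \in B -> x ^+ 2 = y ^+ 2 -> x = y.
  (* For [#|B|] odd, the power [(#|B| + 1) / 2] undoes squaring on [B]. *)
  have sqK z : z \in B -> z = (z ^+ 2) ^+ (#|B|.+1)./2.
    move=> Bz; rewrite -expgM mul2n even_halfK /= ?odd_B //.
    by rewrite expgS expg_cardG ?mulg1.
  by move=> Bx By e; rewrite (sqK x) // e -sqK.
have quo_inj i j : i.+1 < #|G| -> j.+1 < #|G| ->
    (f i)^-1 * f i.+1 = (f j)^-1 * f j.+1 -> i = j.
  (* Equality would make the odd exponent [(2k + 1) + (2l + 2)] of [a] divisible by the even order
     of [a]. *)
  have mixed k l : (f k.*2)^-1 * f k.*2.+1 <> (f l.*2.+1)^-1 * f l.*2.+2.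
    rewrite quo_even quo_odd => e.
    have : (h k ^+ 2 * a ^+ k.*2.+1) * (h l * h l.+1 * a ^+ l.+1.*2) = 1 * a ^+ 0.
      by rewrite e mulVg mulg1.
    rewrite PM ?groupX ?groupM // => /Pinj [] //; first by rewrite !groupM ?groupX.
    move=> _; rewrite mod0n => /eqP /dvdn_odd /implyP.
    by rewrite (negPf even_a) oddD /= !odd_double.
  move=> li lj; have := odd_double_half i; have := odd_double_half j.
  case: (odd i); case: (odd j) => /= <- <-; rewrite ?add0n ?add1n.
  - rewrite !quo_odd => /invg_inj/Pinj []; rewrite ?groupM // => /inj2 e1.
    rewrite !doubleS => e2; congr (_.*2.+1); apply: half_inj => //; try lia.
    by apply/eqP; rewrite -(eqn_modDr 2) !addn2; apply/eqP.
  - by move/esym/mixed.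
  - by move/mixed.
  rewrite !quo_even => /Pinj []; rewrite ?groupX // => /sq_inj e1 e2.
  congr (_.*2); apply: half_inj; try lia; first by apply: inj; apply: e1.
  by apply/eqP; rewrite -(eqn_modDr 1) !addn1; apply/eqP.
(* Left translation makes the first term 1 and leaves the quotients unchanged. *)
pose s := mkseq (fun k => (f 0)^-1 * f k) #|G|.
have ns k : k < #|G| -> nth 1 s k = (f 0)^-1 * f k by move=> lk; rewrite nth_mkseq.
have us : uniq s.
  rewrite map_inj_in_uniq ?iota_uniq // => i j; rewrite !mem_iota /= => li lj.
  by move/mulgI/f_inj; apply.
exists s; split=> //.
- have sG : {subset s <= enum G}.
    by move=> _ /mapP[k _ ->]; rewrite mem_enum groupM ?groupV.
  have [|_ e] := uniq_min_size us sG; first by rewrite size_mkseq -cardE.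
  by move=> x; rewrite e mem_enum.
- by rewrite ns ?mulVg // cardG_gt0.
move=> i j ltij lj.
have li : i.+1 < #|G| by apply: ltn_trans lj.
have shift (u v w : gT) : (u * v)^-1 * (u * w) = v^-1 * w.
  by rewrite invMg -mulgA mulKg.
rewrite !ns ?(ltnW lj) ?(ltnW li) // !shift.
by move/quo_inj => e; rewrite e ?ltnn in ltij.
Qed.

(** * Sufficiency: the Sylow 2-subgroup *)

Lemma unique_involution_cyclic (gT : finGroupType) (A : {group gT}) z :
    abelian A -> 2.-group A -> #[z] = 2 ->
    (forall x, x \in A -> #[x] = 2 -> x = z) -> cyclic A.
Proof.
move=> abA pA oz uz.
rewrite abelian_rank1_cyclic // (rank_pgroup pA) p_rank_abelian //.
(* The rank of [A] is the base 2 logarithm of the order of ['Ohm_1(A)], which is generated by the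
   elements of square 1. *)
have sO : 'Ohm_1(A) \subset <[z]>.
  rewrite (OhmE 1 pA) gen_subG; apply/subsetP => x; rewrite !inE expn1.
  case/andP=> Ax /eqP x2; have [->|ntx] := eqVneq x 1; first exact: group1.
  by rewrite (uz x Ax) ?cycle_id //; apply: nt_prime_order.
by have := dvdn_leq_log 2 (order_gt0 z) (cardSg sO); rewrite oz.
Qed.

Lemma unique_involution_DDP (gT : finGroupType) (G : {group gT}) :
    abelian G -> (exists! x : gT, x \in G /\ #[x]%g = 2) -> DDP G.
Proof.
move=> abG [z [[Gz oz] uz]].
have dG := nilpotent_pcoreC 2 (abelian_nil abG).
have pA := pcore_pgroup 2 G; have pB := pcore_pgroup 2^' G.
have sA := pcore_sub 2 G.
have cA : cyclic 'O_2(G).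
  apply: (unique_involution_cyclic (abelianS sA abG) pA oz) => x Ax ox.
  by apply/esym/uz; split=> //; apply: (subsetP sA).
have [a ea] := cyclicP cA.
have odd_B : odd #|'O_2^'(G)| by rewrite odd_2'nat.
have co : coprime #[a] #|'O_2^'(G)|.
  by rewrite orderE -ea; apply: pnat_coprime pA pB.
apply: (zigzag_DDP (a := a) abG _ _ odd_B co); first by rewrite -ea.
(* The involution makes [#|G|] even; the other factor being odd, [#[a]] is even. *)
have: 2 %| #|G| by rewrite -oz order_dvdG.
rewrite -(dprod_card dG) Euclid_dvdM // !dvdn2 odd_B orbF.
by rewrite ea orderE.
Qed.

(** [ntG] excludes the trivial group, which is vacuously DDP but has no involution. *)
Theorem theorem13 (gT : finGroupType) (G : {group gT})
    (abG : abelian G) (ntG : 1 < #|G|) :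
  DDP G <-> exists! x : gT, x \in G /\ #[x]%g = 2.
Proof.
split; first exact: DDP_unique_involution.
exact: unique_involution_DDP.
Qed.
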